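(* Let $q\ge1$ be an integer, let $G$ be a finite connected $(q+1)$-regular graph with $n$ vertices and adjacency matrix $A$, let $\sigma(A)$ be its set of distinct eigenvalues, $P_\lambda$ the orthogonal projection onto the $\lambda$-eigenspace, and for $|\lambda|<2\sqrt q$ let $\theta_\lambda=\arccos(\lambda/(2\sqrt q))\in(0,\pi)$. For $m\ge0$ set \[\mathbf s_m:=\sum_{\lambda\in\sigma(A),\ |\lambda|<2\sqrt q}U_m\!\left(\frac{\lambda}{2\sqrt q}\right)P_\lambda=\sum_{\lambda\in\sigma(A),\ |\lambda|<2\sqrt q}\frac{\sin((m+1)\theta_\lambda)}{\sin\theta_\lambda}P_\lambda .\] Let $k$ be a positive integer and suppose $\theta_\lambda\notin\bigcap_{j=0}^{[(k-1)/2]}\frac{2\pi}{k-2j}\mathbb Z$ for all $\lambda\in\sigma(A)$ with $|\lambda|<2\sqrt q$. Then, as $N\to\infty$, \[\left\|\frac1N\sum_{m=1}^N\mathbf s_m^k-e_k\frac1{2^k}\binom{k}{k/2}\sum_{\lambda\in\sigma(A),\ |\lambda|<2\sqrt q}\frac{1}{\sin^k\theta_\lambda}P_\lambda\right\|=O\!\left(\frac1N\right),\] where $\|\cdot\|$ is the Euclidean norm on $\mathbb R^{n^2}$.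
   Context: $U_m$ is the Chebyshev polynomial of the second kind, $U_m(\cos\theta)=\sin((m+1)\theta)/\sin\theta$. $e_k=1$ if $k$ is even and $0$ if $k$ is odd (for odd $k$ the binomial term is absent); $[x]$ is the integer part; $\frac{2\pi}{r}\mathbb Z=\{2\pi\ell/r:\ell\in\mathbb Z\}$.
   Formalization: For even k it is also assumed that no θ_λ lies in the union (not just the intersection) of the sets (2π/(k-2j))Z; as printed the claim fails, e.g. for the 4-cycle with q=1, k=4, θ=π/2, where the mean is 1/2, not 3/8. *)

(* Defs.v *)
From HB Require Import structures.
From mathcomp Require Import all_boot all_order all_algebra.
From mathcomp Require Import all_classical all_reals all_analysis.
From mathcomp Require Import ring lra.
Set Implicit Arguments.
Unset Strict Implicit.
Unset Printing Implicit Defensive.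
Import Order.TTheory GRing.Theory Num.Theory.
Import numFieldNormedType.Exports.
Local Open Scope classical_set_scope.
Local Open Scope ring_scope.

Definition simple_graph (n : nat) (e : rel 'I_n) : Prop :=
  symmetric e /\ irreflexive e.

Definition connected_graph (n : nat) (e : rel 'I_n) : Prop :=
  (0 < n)%N /\ forall x y : 'I_n, connect e x y.

Definition regular_graph (n : nat) (e : rel 'I_n) (d : nat) : Prop :=
  forall x : 'I_n, #|[set y | e x y]%SET| = d.

Definition adjacency (R : realType) (n : nat) (e : rel 'I_n) : 'M[R]_n :=
  \matrix_(i, j) (e i j)%:R.

(* The library's `|M| on matrices is the sup norm. *)
Definition frobenius (R : realType) (n : nat) (M : 'M[R]_n) : R :=
  Num.sqrt (\sum_i \sum_j M i j ^+ 2).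

(* Matrices act on row vectors, as for [eigenspace]; on symmetric matrices
   this is the same as acting on columns. *)
Definition orthoproj (R : realType) (n : nat) (V : 'M[R]_n) : 'M[R]_n :=
  proj_mx V (orthomx idfun 1%:M V).

Definition eigenproj (R : realType) (n : nat) (A : 'M[R]_n) (lam : R) :
    'M[R]_n :=
  orthoproj (eigenspace A lam).

(* U_0 = 1, U_1 = 2X, U_(m+2) = 2X U_(m+1) - U_m; see [chebyshevU_cos]. *)
Fixpoint chebyshevU (R : realType) (m : nat) : {poly R} :=
  match m with
  | 0 => 1
  | m'.+1 => match m' with
             | 0 => 'X *+ 2
             | m''.+1 => 'X *+ 2 * chebyshevU R m' - chebyshevU R m''
             end
  end.

Definition tempered (R : realType) (q n : nat) (A : 'M[R]_n) : set R :=
  [set lam | eigenvalue A lam /\ `|lam| < 2 * Num.sqrt q%:R].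

Definition angle (R : realType) (q : nat) (lam : R) : R :=
  acos (lam / (2 * Num.sqrt q%:R)).

Definition s_ (R : realType) (q n : nat) (A : 'M[R]_n) (m : nat) : 'M[R]_n :=
  \sum_(lam \in tempered q A)
    (chebyshevU R m).[lam / (2 * Num.sqrt q%:R)] *: eigenproj A lam.

(* (2 pi / r) Z, for r > 0.  For even k the smallest r = k - 2j is 2, so the
   intersection of these lattices is pi Z, which misses ]0, pi[; excluding it
   does not exclude the resonances.  On the 4-cycle (q = 1, k = 4) the
   eigenvalue 0 has angle pi / 2, and the mean of sin((m + 1) pi / 2) ^ 4 is
   1 / 2, not binom(4, 2) / 2 ^ 4 = 3 / 8.  For even k the union has to be
   excluded; for odd k nothing has to be. *)
Definition angle_lattice (R : realType) (r : nat) : set R :=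
  [set 2 * pi / r%:R * l%:~R | l in [set: int]].

(* e_k 2^-k binom(k, k/2), which is zero for odd k. *)
Definition mean_coef (R : realType) (k : nat) : R :=
  if odd k then 0 else ('C(k, k./2))%:R / 2 ^+ k.

Lemma chebyshevU_cos (R : realType) (m : nat) (t : R) :
  (chebyshevU R m).[cos t] * sin t = sin (m.+1%:R * t).
Proof.
suff: (chebyshevU R m).[cos t] * sin t = sin (m.+1%:R * t) /\
      (chebyshevU R m.+1).[cos t] * sin t = sin (m.+2%:R * t) by case.
elim: m => [|m [IH1 IH2]].
  by split; rewrite /= !hornerE ?mul1r // mulr_natl sin_mulr2n; ring.
split=> //.
rewrite [chebyshevU R m.+2]/= -/(chebyshevU R m.+1) !hornerE.
rewrite mulrBl -mulrA IH1 IH2.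
have -> : m.+3%:R * t = m.+2%:R * t + t.
  by rewrite -[X in _ = _ + X]mul1r -mulrDl natr1.
have -> : m.+1%:R * t = m.+2%:R * t - t.
  by rewrite -[X in _ = _ - X]mul1r -mulrBl -(natr1 m.+1) addrK.
rewrite sinB sinD; ring.
Qed.

Lemma finite_tempered (R : realType) (q n : nat) (A : 'M[R]_n) :
  finite_set (tempered q A).
Proof.
have p0 : char_poly A != 0 by rewrite monic_neq0 ?char_poly_monic.
have [s hs] : exists s : seq R, forall x, root (char_poly A) x -> x \in s.
  have [s [r [-> hr]]] : exists s r, char_poly A = r * \prod_(a <- s) ('X - a%:P)
      /\ forall x, ~~ root r x.
    move: (char_poly A) p0 => p; have [m] := ubnP (size p).
    elim: m p => // m IH p hm p0.
    have [[x rx]|nr] := pselect (exists x, root p x); last first.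
      exists [::], p; rewrite big_nil mulr1; split=> // x.
      by apply/negP => rx; apply: nr; exists x.
    have /factor_theorem [p' E] := rx.
    have p'0 : p' != 0 by apply: contraNneq p0 => p'0; rewrite E p'0 mul0r.
    have [|//|s [r [E' hr]]] := IH p'.
      by move: hm; rewrite E size_Mmonic ?monicXsubC // size_XsubC addn2.
    by exists (x :: s), r; rewrite big_cons E E'; split=> //; ring.
  exists s => x; rewrite rootM (negbTE (hr x)) /=.
  by rewrite root_prod_XsubC.
apply: (@sub_finite_set _ _ [set` s]); last exact: finite_seq.
by move=> x [ev _] /=; apply: hs; rewrite -eigenvalue_root_char.
Qed.

Lemma s_E (R : realType) (q n : nat) (A : 'M[R]_n) (m : nat) :
  s_ q A m = \sum_(lam \in tempered q A)
    (sin (m.+1%:R * angle q lam) / sin (angle q lam)) *: eigenproj A lam.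
Proof.
apply: eq_fsbigr => lam /set_mem[_ hlam]; congr (_ *: _).
set c := 2 * Num.sqrt q%:R in hlam *.
have c0 : 0 < c by apply: le_lt_trans hlam.
have /andP[h1 h2] : -1 < lam / c < 1.
  by rewrite ltr_pdivlMr // ltr_pdivrMr // mulN1r mul1r -ltr_norml.
rewrite -chebyshevU_cos /angle -/c acosK ?in_itv /= ?ltW // mulfK //.
by rewrite gt_eqF // sin_gt0_pi // acos_gt0 ?acos_ltpi ?h1 ?h2 ?ltW.
Qed.

(* Main.v *)
(* A is symmetric, so the P_lambda are pairwise orthogonal idempotents and s_m^k
   is obtained by raising the coefficients to the power k.  With x = (m+1) theta
   and y = x - pi/2, (2 sin x)^k = (2 cos y)^k = sum_j C(k, j) cos((k - 2j) y).
   The term j = k/2 is the limit; each other term is a cosine along an arithmetic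
   progression of step a = (k - 2j) theta, whose partial sums telescope after
   multiplication by 2 sin(a/2), hence are bounded unless a lies in 2 pi Z.
   Dividing by N gives O(1/N). *)
Require Import Defs.
From HB Require Import structures.
From mathcomp Require Import all_boot all_order all_algebra.
From mathcomp Require Import all_classical all_reals all_analysis.
From mathcomp Require Import ring lra.
Set Implicit Arguments.
Unset Strict Implicit.
Unset Printing Implicit Defensive.
Import Order.TTheory GRing.Theory Num.Theory.
Import numFieldNormedType.Exports.
Local Open Scope classical_set_scope.
Local Open Scope ring_scope.

(** * Zeros of sine and powers of sines as sums of cosines *)

Lemma sin_muln_eq0 (R : realType) (x : R) n : sin x = 0 -> sin (n%:R * x) = 0.
Proof.
move=> x0; elim: n => [|n IH]; first by rewrite mul0r sin0.
by rewrite -natr1 mulrDl mul1r sinD IH x0 mul0r mulr0 addr0.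
Qed.

(** Subtracting pi preserves zeros of sine, so x descends into [0, pi[, where sine vanishes only at
    0. *)
Lemma sin_eq0_natmul_pi (R : realType) (x : R) :
  0 <= x -> sin x = 0 -> exists n, x = n%:R * pi.
Proof.
move=> x0 sx0.
have [m] : exists m, x < m%:R * pi.
  exists (Num.truncn (x / pi)).+1.
  by rewrite -ltr_pdivrMr ?pi_gt0 // truncnS_gt.
elim: m x x0 sx0 => [|m IH] x x0 sx0; first by rewrite mul0r ltNge x0.
have [xpi _|pix] := ltP x pi.
  exists 0; rewrite mul0r; apply/eqP; rewrite eq_le x0 andbT leNgt.
  apply/negP => x0'; have : 0 < sin x by rewrite sin_gt0_pi // x0'.
  by rewrite sx0 ltxx.
rewrite -natr1 mulrDl mul1r -ltrBlDr => /IH[||l xl]; first by rewrite subr_ge0.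
  by apply: oppr_inj; rewrite -sinDpi subrK oppr0.
by exists l.+1; rewrite -natr1 mulrDl mul1r -xl subrK.
Qed.

(** The free factor [cos z] makes the induction go through: 2 cos y cos z = cos (z + y) + cos (z -
    y) shifts z both ways, and the two sums merge by Pascal's rule. *)
Lemma expr_cosM (R : realType) (y z : R) k :
  (2 * cos y) ^+ k * cos z =
  \sum_(j < k.+1) 'C(k, j)%:R * cos (z + (k%:R - 2 * j%:R) * y).
Proof.
elim: k z => [|k IH] z.
  by rewrite big_ord1 expr0 mulr0 subrr mul0r addr0.
have -> : (2 * cos y) ^+ k.+1 * cos z =
    (2 * cos y) ^+ k * cos (z + y) + (2 * cos y) ^+ k * cos (z - y).
  by rewrite exprSr cosD cosB; ring.
pose f j := cos (z + (k.+1%:R - 2 * j%:R) * y).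
rewrite !IH [RHS]big_ord_recl /= bin0.
under [X in _ = _ + X]eq_bigr => j _ do
  rewrite /bump leq0n add1n binS natrD mulrDl.
rewrite big_split /= addrA; congr (_ + _).
  transitivity (\sum_(j < k.+2) 'C(k, j)%:R * f j); last first.
    by rewrite big_ord_recl /f bin0.
  rewrite [RHS]big_ord_recr /= bin_small // mulr0n mul0r addr0.
  by apply: eq_bigr => j _; rewrite /f -natr1; congr (_ * cos _); ring.
by apply: eq_bigr => j _; rewrite -!natr1; congr (_ * cos _); ring.
Qed.

Lemma expr_sin (R : realType) (x : R) k :
  (2 * sin x) ^+ k =
  \sum_(j < k.+1) 'C(k, j)%:R * cos ((k%:R - 2 * j%:R) * (x - pi / 2)).
Proof.
have := expr_cosM (x - pi / 2) 0 k; rewrite cos0 mulr1 cosBpihalf => ->.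
by under eq_bigr do rewrite add0r.
Qed.

(** * Bounded partial sums of trigonometric sequences *)

Definition bounded_seq (R : realType) (u : nat -> R) :=
  exists C, forall N, `|u N| <= C.

Lemma bounded_seq_sum (R : realType) (I : eqType) (r : seq I)
    (u : I -> nat -> R) :
  {in r, forall i, bounded_seq (u i)} ->
  bounded_seq (fun N => \sum_(i <- r) u i N).
Proof.
elim: r => [|i r IH] hu; first by exists 0 => N; rewrite big_nil normr0.
have [C hC] := hu i (mem_head _ _).
have [|D hD] := IH; first by move=> j jr; apply: hu; rewrite inE jr orbT.
exists (C + D) => N; rewrite big_cons.
by rewrite (le_trans (ler_normD _ _)) // lerD.
Qed.

Lemma bounded_seqZ (R : realType) (c : R) (u : nat -> R) :
  bounded_seq u -> bounded_seq (fun N => c * u N).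
Proof.
by move=> [C hC]; exists (`|c| * C) => N; rewrite normrM ler_wpM2l.
Qed.

Lemma bounded_sum_cos (R : realType) (a b : R) : sin (a / 2) != 0 ->
  bounded_seq (fun N => \sum_(1 <= m < N.+1) cos (m.+1%:R * a + b)).
Proof.
move=> sa.
(* Discrete antiderivative, sampled at half steps: sin (x + a/2) - sin (x - a/2) = 2 sin (a/2) cos
   x. *)
pose F (m : nat) := sin ((m%:R + 2^-1) * a + b) / (2 * sin (a / 2)).
exists (`|(2 * sin (a / 2))^-1| * 2) => N.
have -> : \sum_(1 <= m < N.+1) cos (m.+1%:R * a + b) = F N.+1 - F 1%N.
  rewrite -telescope_sumr //; apply: eq_bigr => m _; rewrite /F -mulrBl.
  set x := m.+1%:R * a + b.
  have -> : (m.+1%:R + 2^-1) * a + b = x + a / 2 by rewrite /x; ring.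
  have -> : (m%:R + 2^-1) * a + b = x - a / 2 by rewrite /x -natr1; field.
  by rewrite sinB sinD; field.
rewrite /F -mulrBl mulrC normrM ler_wpM2l //.
by rewrite (le_trans (ler_normB _ _)) // (_ : 2 = 1 + 1) // lerD ?sin_max.
Qed.

(** Spreads the mean over the harmonics, so that it can be subtracted from the expansion of (2 sin
    x)^k term by term; for odd k no index has 2j = k. *)
Lemma mean_coef_sum (R : realType) k :
  2 ^+ k * mean_coef R k = \sum_(j < k.+1) 'C(k, j)%:R * (j.*2 == k)%:R.
Proof.
rewrite /mean_coef; case: ifPn => [ok|ek].
  rewrite mulr0 big1 // => j _; case: eqP => [jk|]; last by rewrite mulr0.
  by have := odd_double j; rewrite jk ok.
have jk : (k./2 < k.+1)%N.
  by rewrite ltnS -{2}(doubleK k) half_leq // -addnn leq_addr.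
rewrite (bigD1 (Ordinal jk)) //= even_halfK // eqxx mulr1 big1 => [|j].
  by rewrite addr0 mulrC divfK // expf_neq0 ?pnatr_eq0.
rewrite -val_eqE /= => jk2; case: eqP => [E|]; last by rewrite mulr0.
by have := doubleK j; rewrite E => Ej; rewrite Ej eqxx in jk2.
Qed.

(* A resonance sin ((k - 2j) t / 2) = 0 is harmless for odd k, where the
   harmonic of frequency k - 2j vanishes along the orbit. *)
Lemma bounded_sum_expr_sin (R : realType) (t : R) k :
  (~~ odd k -> forall j, (j <= k)%N -> j.*2 != k ->
     sin ((k%:R - 2 * j%:R) * t / 2) != 0) ->
  bounded_seq (fun N =>
    \sum_(1 <= m < N.+1) (sin (m.+1%:R * t) ^+ k - mean_coef R k)).
Proof.
move=> nres.
pose h (j m : nat) : R :=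
  cos ((k%:R - 2 * j%:R) * (m.+1%:R * t - pi / 2)) - (j.*2 == k)%:R.
have E N : \sum_(1 <= m < N.+1) (sin (m.+1%:R * t) ^+ k - mean_coef R k) =
    \sum_(j < k.+1) (2 ^- k * 'C(k, j)%:R) * \sum_(1 <= m < N.+1) h j m.
  under [RHS]eq_bigr do rewrite mulr_sumr.
  rewrite exchange_big /=; apply: eq_bigr => m _.
  have k2 : 2 ^+ k != 0 :> R by rewrite expf_neq0 // pnatr_eq0.
  apply: (mulfI k2); rewrite mulrBr mean_coef_sum -exprMn expr_sin -sumrB.
  by rewrite mulr_sumr; apply: eq_bigr => j _; rewrite -mulrBr -[in RHS]mulrA mulVKf.
suff hb j : (j <= k)%N -> bounded_seq (fun N => \sum_(1 <= m < N.+1) h j m).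
  have [|C hC] := @bounded_seq_sum R _ (index_enum 'I_k.+1)
      (fun j N => 2 ^- k * 'C(k, j)%:R * \sum_(1 <= m < N.+1) h j m).
    by move=> j _; apply: bounded_seqZ; apply: hb; rewrite -ltnS.
  by exists C => N; rewrite E.
move=> jk; have [jk2|jk2] := eqVneq j.*2 k.
  exists 0 => N; rewrite big1 ?normr0 // => m _; rewrite /h jk2 eqxx.
  by rewrite -jk2 -mul2n natrM subrr mul0r cos0 subrr.
pose d : R := k%:R - 2 * j%:R.
have hE m : h j m = cos (m.+1%:R * (d * t) + - (d * (pi / 2))).
  by rewrite /h (negbTE jk2) subr0 /d; congr cos; ring.
under eq_fun do under eq_bigr do rewrite hE.
have [dt0|] := eqVneq (sin (d * t / 2)) 0; last exact: bounded_sum_cos.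
have ok : odd k.
  by apply/negPn/negP => ek; move: (nres ek j jk jk2); rewrite -/d dt0 eqxx.
(* The harmonic is cos (u - v) with u = (m + 1) d t and v = d pi / 2. Resonance gives sin u = 0;
   since k, hence d, is odd, v is an odd multiple of pi / 2 and cos v = 0. *)
exists 0 => N; rewrite big1 ?normr0 // => m _; rewrite cosB.
have -> : d * t = 2 * (d * t / 2) by field.
rewrite mulrA -natrM sin_muln_eq0 // mul0r addr0.
have -> : d * (pi / 2) = k./2%:R * pi + pi / 2 - j%:R * pi.
  have kE : k%:R = 1 + 2 * k./2%:R :> R.
    by rewrite -{1}(odd_double_half k) ok natrD -mul2n natrM.
  by rewrite /d kE; field.
rewrite cosB cosDpihalf sin_muln_eq0 ?sinpi // oppr0 mul0r add0r.
by rewrite [X in _ * (_ * X)]sin_muln_eq0 ?sinpi // !mulr0.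
Qed.

(** * Orthogonal idempotents and the spectral projections *)

Lemma sum_orth_idem_exp (R : realType) n (I : eqType) (r : seq I)
    (P : I -> 'M[R]_n) (c : I -> R) k :
  uniq r -> {in r &, forall i j, i != j -> P i *m P j = 0} ->
  {in r, forall i, P i *m P i = P i} ->
  (\sum_(i <- r) c i *: P i) ^+ k.+1 = \sum_(i <- r) c i ^+ k.+1 *: P i.
Proof.
move=> ur orth idem; elim: k => [//|k IH].
rewrite exprS IH -[LHS]/(mulmx _ _) mulmx_suml.
rewrite big_seq [RHS]big_seq; apply: eq_bigr => i ir.
rewrite mulmx_sumr (bigD1_seq i) //= big_seq_cond big1 => [|j /andP[jr ji]].
  by rewrite addr0 -scalemxAl -scalemxAr idem // scalerA -exprS.
by rewrite -scalemxAl -scalemxAr orth // 1?eq_sym // !scaler0.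
Qed.

Lemma orthomx_idP (R : realType) n m p (A : 'M[R]_(m, n)) (B : 'M[R]_(p, n)) :
  reflect (A *m B^T = 0) (A <= orthomx idfun 1%:M B)%MS.
Proof. by apply: (iffP sub_kermxP); rewrite mul1mx map_mx_id. Qed.

Lemma row_mul_tr_eq0 (R : realType) n (v : 'rV[R]_n) : v *m v^T = 0 -> v = 0.
Proof.
move=> /matrixP/(_ 0 0); rewrite !mxE => /eqP.
rewrite psumr_eq0 => [/allP h|i _]; last by rewrite mxE -expr2 sqr_ge0.
apply/rowP => i; have := h i (mem_index_enum _); rewrite !mxE -expr2 sqrf_eq0.
by move/eqP.
Qed.

(** A common vector v has v v^T = 0, a sum of real squares. This trivial intersection is what makes
    [proj_mx] along the complement a genuine projection. *)
Lemma capmx_orthomx (R : realType) n (V : 'M[R]_n) :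
  (V :&: orthomx idfun 1%:M V = 0)%MS.
Proof.
apply/eqP/rowV0P => v; rewrite sub_capmx => /andP[/submxP[w ->] /orthomx_idP h].
by apply: row_mul_tr_eq0; rewrite trmx_mul mulmxA h mul0mx.
Qed.

Lemma eigenproj_sub (R : realType) n (A : 'M[R]_n) lam :
  (eigenproj A lam <= eigenspace A lam)%MS.
Proof. by rewrite -[eigenproj _ _]mul1mx proj_mx_sub. Qed.

Lemma eigenproj_idem (R : realType) n (A : 'M[R]_n) lam :
  eigenproj A lam *m eigenproj A lam = eigenproj A lam.
Proof. exact/proj_mx_proj/capmx_orthomx. Qed.

(** With W the first projection and V the mu-eigenspace, symmetry gives lam W V^T = W A V^T = mu W
    V^T. Hence W V^T = 0, and the second projection kills the rows of W. *)
Lemma eigenproj_orth (R : realType) n (A : 'M[R]_n) lam mu :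
  A^T = A -> lam != mu -> eigenproj A lam *m eigenproj A mu = 0.
Proof.
move=> symA lm; apply: proj_mx_0; first exact: capmx_orthomx.
apply/orthomx_idP; set V := eigenspace A mu; set W := eigenproj A lam.
have /eigenspaceP hW : (W <= eigenspace A lam)%MS by exact: eigenproj_sub.
have /eigenspaceP hV := submx_refl V.
clearbody V W.
have : (lam - mu) *: (W *m V^T) = 0.
  rewrite scalerBl scalemxAl -hW scalemxAr -linearZ /= -hV trmx_mul symA.
  by rewrite mulmxA subrr.
by move/eqP; rewrite scaler_eq0 subr_eq0 (negbTE lm) => /eqP.
Qed.

(** * Frobenius norm against the sum of absolute entries *)

Lemma sum_sqr_le (R : realType) (I : Type) (r : seq I) (F : I -> R) :
  \sum_(i <- r) F i ^+ 2 <= (\sum_(i <- r) `|F i|) ^+ 2.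
Proof.
elim: r => [|i r IH]; first by rewrite !big_nil expr0n.
have S0 : 0 <= \sum_(j <- r) `|F j| by exact: sumr_ge0.
rewrite !big_cons sqrrD real_normK ?num_real // -addrA lerD2l.
by rewrite (le_trans IH) // lerDr mulrn_wge0 // mulr_ge0.
Qed.

Lemma frobenius_le_sum (R : realType) n (M : 'M[R]_n) :
  frobenius M <= \sum_i \sum_j `|M i j|.
Proof.
rewrite /frobenius !pair_big /=.
rewrite -[leRHS]ger0_norm ?sumr_ge0 // -sqrtr_sqr ler_wsqrtr //.
exact: sum_sqr_le.
Qed.

(** * Angles and resonance lattices *)

Lemma angle_itv (R : realType) (q : nat) (lam : R) :
  `|lam| < 2 * Num.sqrt q%:R -> 0 < angle q lam < pi.
Proof.
set c := 2 * _ => hlam; have c0 : 0 < c by apply: le_lt_trans hlam.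
have /andP[h1 h2] : -1 < lam / c < 1.
  by rewrite ltr_pdivlMr // ltr_pdivrMr // mulN1r mul1r -ltr_norml.
by rewrite /angle -/c acos_gt0 ?acos_ltpi ?h1 ?h2 ?ltW.
Qed.

Lemma angle_lattice_of_sin_eq0 (R : realType) (r : nat) (t : R) :
  (0 < r)%N -> 0 < t -> sin (r%:R * t / 2) = 0 -> angle_lattice r t.
Proof.
move=> r0 t0 /sin_eq0_natmul_pi[|m hm].
  by rewrite divr_ge0 // mulr_ge0 // ltW.
exists m%:Z => //; rewrite -pmulrn.
have rn0 : r%:R != 0 :> R by rewrite pnatr_eq0 -lt0n.
have E : t = 2 / r%:R * (r%:R * t / 2) by field.
by rewrite [RHS]E hm; field.
Qed.

(** The lattices only list the positive frequencies k - 2j. When 2j > k, the index k - j has the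
    opposite frequency, and sine is odd. *)
Lemma even_nonresonant (R : realType) (k : nat) (t : R) : 0 < t ->
  ~ (\bigcup_(j in [set j | (j <= (k - 1)./2)%N]) angle_lattice (k - 2 * j)) t ->
  forall j, (j <= k)%N -> j.*2 != k -> sin ((k%:R - 2 * j%:R) * t / 2) != 0.
Proof.
move=> t0 nres j jk jk2; apply/negP => /eqP s0; apply: nres.
have [lt|gt] := ltnP j.*2 k.
  exists j.
    by rewrite /= geq_half_double subn1 -ltnS prednK // (leq_trans _ lt).
  apply: angle_lattice_of_sin_eq0 => //; first by rewrite subn_gt0 mul2n.
  by rewrite natrB ?natrM // mul2n ltnW.
have {}gt : (k < j.*2)%N by rewrite ltn_neqAle eq_sym jk2.
have le : (2 * (k - j) < k)%N.
  rewrite mul2n doubleB ltn_subLR ?leq_double //.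
  by rewrite -!addnn ltn_add2r addnn.
exists (k - j)%N.
  by rewrite /= geq_half_double subn1 -ltnS prednK -?mul2n // (leq_trans _ le).
apply: angle_lattice_of_sin_eq0 => //; first by rewrite subn_gt0.
rewrite natrB 1?ltnW // natrM natrB //.
rewrite (_ : _ / 2 = - ((k%:R - 2 * j%:R) * t / 2)); last by ring.
by rewrite sinN s0 oppr0.
Qed.

(** * Convergence of the means *)

Theorem theorem4p4 (R : realType) (q n : nat) (e : rel 'I_n) (k : nat)
    (hq : (1 <= q)%N)
    (hsimple : simple_graph e)
    (hconn : connected_graph e)
    (hreg : regular_graph e q.+1)
    (hk : (0 < k)%N)
    (hcap : forall lam : R, tempered q (adjacency R e) lam ->
      ~ (\bigcap_(j in [set j | (j <= (k - 1)./2)%N])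
           angle_lattice (k - 2 * j)) (angle q lam))
    (hcup : ~~ odd k -> forall lam : R, tempered q (adjacency R e) lam ->
      ~ (\bigcup_(j in [set j | (j <= (k - 1)./2)%N])
           angle_lattice (k - 2 * j)) (angle q lam)) :
  (fun N : nat =>
     frobenius
       (N%:R^-1 *: (\sum_(1 <= m < N.+1) s_ q (adjacency R e) m ^+ k)
        - mean_coef R k *:
            \sum_(lam \in tempered q (adjacency R e))
              (sin (angle q lam) ^+ k)^-1 *: eigenproj (adjacency R e) lam)
     : R^o)
  =O_\oo (fun N : nat => N%:R^-1 : R^o).
Proof.
set A := adjacency R e in hcap hcup *.
have symA : A^T = A.
  by apply/matrixP => i j; rewrite !mxE hsimple.1.
have fT := finite_tempered q A.
pose r := finmap.enum_fset (fset_set (tempered q A)).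
have ur : uniq r by exact: finmap.fset_uniq.
have rT lam : lam \in r -> tempered q A lam.
  by move=> lr; apply/set_mem; rewrite -(in_fset_set fT).
pose P := eigenproj A.
(* N times the coefficient of [P lam] in the difference to be estimated. *)
pose b (lam : R) (N : nat) : R := (sin (angle q lam) ^- k) *
  \sum_(1 <= m < N.+1) (sin (m.+1%:R * angle q lam) ^+ k - mean_coef R k).
have bb lam : lam \in r -> bounded_seq (b lam).
  (* For even k a resonant harmonic could shift the mean; [hcup] rules out each one. *)
  move=> /rT hl; apply: bounded_seqZ; apply: bounded_sum_expr_sin => ek.
  apply: even_nonresonant; last exact: hcup.
  by have /andP[] := angle_itv hl.2.
have sE m : s_ q A m ^+ k = \sum_(lam <- r)
    (sin (m.+1%:R * angle q lam) / sin (angle q lam)) ^+ k *: P lam.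
  (* A positive exponent matters: the zeroth power is the identity, not the sum of the [P lam]. *)
  rewrite s_E fsbig_finite //= -/r -(prednK hk) sum_orth_idem_exp //.
  - by move=> lam mu _ _; exact: eigenproj_orth.
  - by move=> lam _; exact: eigenproj_idem.
(* At N = 0 the inverse is 0 by convention, which would leave the limit term uncancelled. *)
have DE N : (0 < N)%N ->
    N%:R^-1 *: (\sum_(1 <= m < N.+1) s_ q A m ^+ k)
    - mean_coef R k *: \sum_(lam \in tempered q A)
        (sin (angle q lam) ^+ k)^-1 *: eigenproj A lam =
    N%:R^-1 *: \sum_(lam <- r) b lam N *: P lam.
  move=> N0; have Nn0 : N%:R != 0 :> R by rewrite pnatr_eq0 -lt0n.
  under eq_bigr do rewrite sE.
  rewrite fsbig_finite //= -/r exchange_big /= -[X in _ - X](scalerK Nn0).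
  rewrite -scalerBr; congr (_ *: _).
  rewrite !scaler_sumr -sumrB; apply: eq_bigr => lam _.
  rewrite -scaler_suml !scalerA -scalerBl; congr (_ *: _).
  rewrite /b big_split /= sumr_const_nat subn1 /= mulrDr mulr_sumr -mulr_natr.
  congr (_ + _); last by ring.
  by apply: eq_bigr => m _; rewrite expr_div_n mulrC.
have [C hC] : bounded_seq (fun N =>
    \sum_i \sum_j `|(\sum_(lam <- r) b lam N *: P lam) i j|).
  apply: bounded_seq_sum => i _; apply: bounded_seq_sum => j _.
  have [|C hC] := @bounded_seq_sum R _ r (fun lam N => P lam i j * b lam N).
    by move=> lam lr; apply: bounded_seqZ; exact: bb.
  exists C => N; rewrite normr_id; move: (hC N); congr (`|_| <= _).
  by rewrite summxE; apply: eq_bigr => lam _; rewrite !mxE mulrC.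
(* The big-O constant has to be strictly positive, hence the added 1. *)
apply/eqOP/bigO_exP; exists (`|C| + 1) => /=; first by rewrite ltr_wpDl.
exists 1%N => // N /= N0; rewrite DE //.
rewrite ger0_norm ?sqrtr_ge0 // (le_trans (frobenius_le_sum _)) //.
under eq_bigr => i _ do under eq_bigr => j _ do rewrite mxE normrM.
under eq_bigr do rewrite -mulr_sumr.
rewrite -mulr_sumr mulrC ler_wpM2r //.
rewrite (le_trans (ler_norm _)) // (le_trans (hC N)) //.
by rewrite (le_trans (ler_norm _)) // lerDl.
Qed.
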